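(* If $D$ and $H$ are Bott equivalent acyclic digraphs, then for each pair of $i$ and $k$, $L_i(D)$ and $L_i(H)$ have the same number of sibling groups having exactly $k$ vertices; that is, the number of sibling groups of $D$ contained in $L_i(D)$ with exactly $k$ vertices equals the number of sibling groups of $H$ contained in $L_i(H)$ with exactly $k$ vertices.
   Context: A digraph $D=(V,E)$ consists of a finite vertex set $V=V(D)$ and a set $E$ of ordered pairs $(u,v)$ of distinct vertices (arcs). $D$ is acyclic if its vertices can be ordered $v_1,\dots,v_n$ so that $i<j$ for each arc $(v_i,v_j)$. Let $N_D^+(v)=\{w:(v,w)\in E\}$ (out-neighbors) and $N_D^-(v)=\{u:(u,v)\in E\}$ (in-neighbors). Bott equivalence. Local complementation at a vertex $v$: $D*v$ is the digraph obtained from $D$ by toggling (adding if absent, removing if present) the arc $(u,w)$ for each pair $(u,w)\in N_D^-(v)\times N_D^+(v)$ with $u\ne w$. Slide: for two distinct vertices $v,w$ with $N_D^-(v)=N_D^-(w)$, $D\Delta vw$ is the digraph obtained from $D$ by replacing $N_D^+(w)$ by the symmetric difference $N_D^+(w)\Delta N_D^+(v)$. These operations preserve acyclicity. An acyclic digraph $H$ is Bott equivalent to an acyclic digraph $D$ if $H$ is isomorphic to a digraph obtained from $D$ by successively applying (finitely many) local complementations and slides. Levels. For an acyclic digraph $D$, $L_k(D)$ is the set of vertices $v$ such that a longest directed path of $D$ ending at $v$ has exactly $k$ edges. Sibling groups. For vertices $x,y$ of $D$ write $x\sim_D y$ if $N_D^-(x)=N_D^-(y)$. This is an equivalence relation on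 $V(D)$, and its equivalence classes are called the sibling groups of $D$. Each level $L_i(D)$ is a disjoint union of sibling groups. *)

(* Defs.v *)
From mathcomp Require Import all_boot.
From Stdlib Require Import Relation_Operators.

Set Implicit Arguments.
Unset Strict Implicit.
Unset Printing Implicit Defensive.

Record digraph (V : finType) := Digraph {
  arcs : {set V * V};
  arcs_loopless : [forall v, (v, v) \notin arcs]
}.

Definition arc (V : finType) (D : digraph V) : rel V :=
  fun u v => (u, v) \in arcs D.

Lemma arc_irr (V : finType) (D : digraph V) (v : V) : arc D v v = false.
Proof. by move/forallP: (arcs_loopless D) => /(_ v)/negbTE. Qed.

Definition out_nbrs (V : finType) (D : digraph V) (v : V) : {set V} :=
  [set w | arc D v w].

Definition in_nbrs (V : finType) (D : digraph V) (v : V) : {set V} :=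
  [set u | arc D u v].

(* [index v s] is the position of [v] in the ordering [s] of the vertices. *)
Definition acyclic (V : finType) (D : digraph V) : Prop :=
  exists2 s : seq V, perm_eq s (enum V) &
    forall u v : V, arc D u v -> index u s < index v s.

Definition isomorphic (V W : finType) (D : digraph V) (H : digraph W) : Prop :=
  exists2 f : V -> W, bijective f & forall u v : V, arc H (f u) (f v) = arc D u v.

Definition lc_arcs (V : finType) (D : digraph V) (v : V) : {set V * V} :=
  [set e | arc D e.1 e.2 (+)
     [&& e.1 \in in_nbrs D v, e.2 \in out_nbrs D v & e.1 != e.2]].

Lemma lc_loopless (V : finType) (D : digraph V) (v : V) :
  [forall x, (x, x) \notin lc_arcs D v].
Proof. by apply/forallP => x; rewrite inE /= arc_irr eqxx !andbF. Qed.

Definition local_compl (V : finType) (D : digraph V) (v : V) : digraph V :=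
  Digraph (lc_loopless D v).

Definition slide_arcs (V : finType) (D : digraph V) (v w : V) : {set V * V} :=
  [set e | if e.1 == w
           then (e.2 \in out_nbrs D w) (+) (e.2 \in out_nbrs D v)
           else arc D e.1 e.2].

(* If v and w have the same in-neighbours, then there is no arc (v, w), since
   it would force a loop at v; so the slide creates no loop at w. *)
Lemma slide_loopless (V : finType) (D : digraph V) (v w : V) :
  in_nbrs D v = in_nbrs D w -> [forall x, (x, x) \notin slide_arcs D v w].
Proof.
move=> /setP/(_ v); rewrite !inE arc_irr => vw.
apply/forallP => x; rewrite inE /=; case: eqP => [->|_]; last by rewrite arc_irr.
by rewrite !inE arc_irr -vw.
Qed.

Definition slide (V : finType) (D : digraph V) (v w : V)
    (vw : in_nbrs D v = in_nbrs D w) : digraph V :=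
  Digraph (slide_loopless vw).

Inductive bott_step (V : finType) (D : digraph V) : digraph V -> Prop :=
| Bott_lc (v : V) : bott_step D (local_compl D v)
| Bott_slide (v w : V) (neq_vw : v != w) (vw : in_nbrs D v = in_nbrs D w) :
    bott_step D (slide vw).

Definition bott_equivalent (V W : finType) (H : digraph W) (D : digraph V) : Prop :=
  exists2 D' : digraph V,
    clos_refl_trans (digraph V) (@bott_step V) D D' & isomorphic H D'.

Definition has_path_to (V : finType) (D : digraph V) (v : V) (m : nat) : bool :=
  [exists x : V, exists p : m.-tuple V,
     [&& path (arc D) x p, uniq (x :: p) & last x p == v]].

(* The vertices of a path are distinct, so it has fewer than #|V| edges; the
   trivial path always contributes the value 0. *)
Definition longest_path_to (V : finType) (D : digraph V) (v : V) : nat :=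
  \max_(m < #|V| | has_path_to D v m) m.

Definition level (V : finType) (D : digraph V) (k : nat) : {set V} :=
  [set v | longest_path_to D v == k].

Definition sibling (V : finType) (D : digraph V) : rel V :=
  fun x y => in_nbrs D x == in_nbrs D y.

Definition sibling_groups (V : finType) (D : digraph V) : {set {set V}} :=
  equivalence_partition (sibling D) [set: V].

(* Main.v *)
From mathcomp Require Import all_boot.
From Stdlib Require Import Relation_Operators.
(* Imported last: [arc] must denote the arcs of a digraph, not [path.arc]. *)
Require Import Defs.

Set Implicit Arguments.
Unset Strict Implicit.
Unset Printing Implicit Defensive.

(** In an acyclic digraph the level function is the only [r] such that [r x]
    is the maximum of [r u + 1] over the in-neighbours [u] of [x].  Both Bott
    moves have the same shape: for some vertex [v] and some set [A] of vertices
    of level at most that of [v], with [v] not in [A], the in-neighbourhood of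
    every out-neighbour of [v] is replaced by its symmetric difference with
    [A].  Two siblings are both out-neighbours of [v] or neither is, so they
    remain siblings, and the out-neighbours of [v] keep their level because [v]
    stays among their in-neighbours.  Hence Bott moves fix every level and every
    sibling group. *)

(** The empty maximum is 0, so sources get level 0. *)
Definition is_level (V : finType) (D : digraph V) (r : V -> nat) : Prop :=
  forall x, r x = \max_(u | arc D u x) (r u).+1.

Definition toggles_in_nbrs (V : finType) (D D' : digraph V) (v : V)
    (A : pred V) : Prop :=
  forall u x, arc D' u x = arc D u x (+) (arc D v x && A u).

Section Level.
Variables (V : finType) (D : digraph V) (r : V -> nat).
Hypothesis rD : is_level D r.

Lemma is_level_arc u x : arc D u x -> r u < r x.
Proof.
by move=> ux; rewrite [r x]rD; apply: (leq_bigmax_cond (F := fun u => (r u).+1)).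
Qed.

Lemma is_level_path x p : path (arc D) x p -> r x + size p <= r (last x p).
Proof.
elim: p x => [|y p IHp] x /=; first by rewrite addn0.
case/andP=> /is_level_arc xy /IHp; apply: leq_trans.
by rewrite addnS -addSn leq_add2r.
Qed.

Lemma is_level_path_uniq x p : path (arc D) x p -> uniq (x :: p).
Proof.
move=> xp; apply: (@sorted_uniq _ (fun u w => r u < r w)).
- by move=> ? ? ?; apply: ltn_trans.
- by move=> ?; apply: ltnn.
- by rewrite /=; apply: sub_path xp => u w; apply: is_level_arc.
Qed.

(** Walk backwards from [x], choosing at each vertex an in-neighbour that attains the maximum, until
    level 0. *)
Lemma is_level_path_exists x :
  exists y p, [/\ path (arc D) y p, last y p = x & size p = r x].
Proof.
have [n] := ubnP (r x); elim: n x => // n IHn x; rewrite ltnS => rxn.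
case: (posnP (r x)) => [->|rx_gt0]; first by exists x, [::].
have [u ux ru] : exists2 u, arc D u x & r x = (r u).+1.
  have : 0 < #|[pred u | arc D u x]|.
    rewrite lt0n; apply: contraTneq rx_gt0 => /card0_eq no_in.
    by rewrite rD big_pred0.
  by move/(eq_bigmax_cond (fun u => (r u).+1)) => [u ux E]; exists u; rewrite // rD.
have [|y [p [yp lastp sizep]]] := IHn u; first by rewrite -ru.
exists y, (rcons p x); split; last by rewrite size_rcons sizep ru.
  by rewrite rcons_path yp lastp.
by rewrite last_rcons.
Qed.

Lemma longest_path_to_is_level x : longest_path_to D x = r x.
Proof.
apply/eqP; rewrite eqn_leq; apply/andP; split.
  apply/bigmax_leqP => m /existsP[y /existsP[p /and3P[yp _ /eqP lastp]]].
  move/is_level_path: yp; rewrite lastp size_tuple; apply: leq_trans.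
  exact: leq_addl.
have [y [p [yp lastp sizep]]] := is_level_path_exists x.
have yp_uniq := is_level_path_uniq yp.
(* [longest_path_to] only ranges over lengths below [#|V|]; a duplicate-free path with [r x] edges
   has [r x + 1] vertices. *)
have rx_lt : r x < #|V|.
  by rewrite -sizep -[(size p).+1]/(size (y :: p)) -(card_uniqP yp_uniq) max_card.
apply: (@bigmax_sup _ (Ordinal rx_lt)) => //=.
apply/existsP; exists y; apply/existsP.
exists (@Tuple (r x) _ p (introT eqP sizep)).
by rewrite yp yp_uniq lastp eqxx.
Qed.

End Level.

Lemma acyclic_is_level (V : finType) (D : digraph V) :
  acyclic D -> exists r, is_level D r.
Proof.
case=> s s_enum arc_lt.
(* Iterate the level recurrence from the zero function: the value at [x] is stable after
   [index x s + 1] rounds, since in-neighbours come earlier in [s]. *)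
pose h n := iter n (fun g (x : V) => \max_(u | arc D u x) (g u).+1) (fun=> 0).
have stable n x : index x s < n -> h n.+1 x = h n x.
  elim: n x => // n IHn x x_n; apply: eq_bigr => u ux; congr _.+1.
  by apply: IHn; apply: leq_trans (arc_lt _ _ ux) _.
exists (h (size s)) => x; rewrite -[LHS]stable // index_mem.
by rewrite (perm_mem s_enum) mem_enum.
Qed.

Lemma sibling_arcP (V : finType) (D : digraph V) (x y : V) :
  reflect (forall u, arc D u x = arc D u y) (sibling D x y).
Proof.
apply: (iffP eqP) => [/setP xy u|xy]; first by have := xy u; rewrite !inE.
by apply/setP => u; rewrite !inE.
Qed.

Section Toggle.
Variables (V : finType) (v : V) (A : pred V).
Hypothesis vA : ~~ A v.

(** As [v] is not in [A], the toggle keeps the out-neighbours of [v], so repeating it undoes it. *)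
Lemma toggles_in_nbrs_sym (D D' : digraph V) :
  toggles_in_nbrs D D' v A -> toggles_in_nbrs D' D v A.
Proof.
by move=> DD' u x; rewrite !DD' (negbTE vA) andbF addbF -addbA addbb addbF.
Qed.

Lemma toggles_sibling_sub (D D' : digraph V) (x y : V) :
  toggles_in_nbrs D D' v A -> sibling D x y -> sibling D' x y.
Proof. by move=> DD' /sibling_arcP xy; apply/sibling_arcP => u; rewrite !DD' !xy. Qed.

Lemma toggles_sibling (D D' : digraph V) :
  toggles_in_nbrs D D' v A -> sibling D =2 sibling D'.
Proof.
move=> DD' x y; apply/idP/idP; apply: toggles_sibling_sub => //.
exact: toggles_in_nbrs_sym.
Qed.

(** A new in-neighbour [u] of [x] lies in [A], and then [v] is already an in-neighbour of [x] with
    [r u <= r v]. *)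
Lemma toggles_max_leq (D D' : digraph V) (r : V -> nat) (x : V) :
    toggles_in_nbrs D D' v A -> (forall u, A u -> r u <= r v) ->
  \max_(u | arc D' u x) (r u).+1 <= \max_(u | arc D u x) (r u).+1.
Proof.
move=> DD' rA; apply/bigmax_leqP => u; rewrite DD'.
case ux: (arc D u x); first by rewrite (leq_bigmax_cond (F := fun u => (r u).+1)).
case/andP=> vx Au.
apply: (@leq_trans (r v).+1); first by rewrite ltnS rA.
exact: (leq_bigmax_cond (F := fun u => (r u).+1)).
Qed.

Lemma toggles_is_level (D D' : digraph V) (r : V -> nat) :
    toggles_in_nbrs D D' v A -> (forall u, A u -> r u <= r v) ->
  is_level D r -> is_level D' r.
Proof.
move=> DD' rA rD x; rewrite [LHS]rD; apply/eqP; rewrite eqn_leq.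
by rewrite !toggles_max_leq //; apply: toggles_in_nbrs_sym.
Qed.

End Toggle.

Lemma bott_step_toggles (V : finType) (D D' : digraph V) (r : V -> nat) :
    is_level D r -> bott_step D D' ->
  exists v A, [/\ ~~ A v, forall u, A u -> r u <= r v & toggles_in_nbrs D D' v A].
Proof.
move=> rD [v | v w neq_vw vw].
  (* For a local complementation, [A] is the in-neighbourhood of [v]. *)
  exists v, [pred u | arc D u v]; split=> [|u /(is_level_arc rD)/ltnW //|u x].
    by rewrite /= arc_irr.
  rewrite {1}/arc !inE /=; congr (_ (+) _).
  case vx: (arc D v x); rewrite ?andbF //=.
  (* The condition [u != x] is automatic: [u -> v -> x] forces [r u < r x]. *)
  case uv: (arc D u v) => //=; apply/eqP => ux.
  have := is_level_arc rD vx; rewrite -ux.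
  by rewrite ltnNge (ltnW (is_level_arc rD uv)).
(* For a slide, [A] is [{w}]; equal in-neighbourhoods give [r w = r v]. *)
exists v, (pred1 w); split=> [//|u /eqP-> | u x].
  rewrite [r w]rD [r v]rD (eq_bigl (fun u => arc D u v)) // => u'.
  by move/setP/(_ u'): vw; rewrite !inE.
rewrite {1}/arc !inE /=; case: eqP => [->|_]; last by rewrite andbF addbF.
by rewrite andbT.
Qed.

Lemma bott_steps_invariant (V : finType) (D D' : digraph V) (r : V -> nat) :
    clos_refl_trans (digraph V) (@bott_step V) D D' -> is_level D r ->
  is_level D' r /\ sibling D =2 sibling D'.
Proof.
elim=> {D D'} [D D' DD' rD | // | D D1 D2 _ IH1 _ IH2 /IH1[/IH2[rD2 sib2] sib1]].
  have [v [A [vA rA tog]]] := bott_step_toggles rD DD'.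
  split; first exact: (toggles_is_level vA tog rA rD).
  exact: (toggles_sibling vA tog).
by split=> // x y; rewrite sib1.
Qed.

Lemma isomorphic_is_level (V W : finType) (D : digraph V) (H : digraph W)
    (f : V -> W) (r : W -> nat) :
    bijective f -> (forall u v, arc H (f u) (f v) = arc D u v) ->
  is_level H r -> is_level D (r \o f).
Proof.
move=> bij_f fE rH x /=; rewrite rH (reindex f) /=; last exact: onW_bij.
by apply: eq_bigl => u; rewrite fE.
Qed.

Lemma isomorphic_sibling (V W : finType) (D : digraph V) (H : digraph W)
    (f : V -> W) :
    bijective f -> (forall u v, arc H (f u) (f v) = arc D u v) ->
  forall x y, sibling H (f x) (f y) = sibling D x y.
Proof.
move=> [g fK gK] fE x y; apply/sibling_arcP/sibling_arcP => xy u.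
  by rewrite -!fE.
by rewrite -[u]gK !fE.
Qed.

(** Taking images under [f] is injective on vertex sets and carries the groups counted for [D] onto
    those counted for [H]. *)
Lemma card_sibling_groups_bij (V W : finType) (D : digraph V) (H : digraph W)
    (f : V -> W) (i k : nat) :
    bijective f ->
    (forall x y, sibling H (f x) (f y) = sibling D x y) ->
    (forall x, longest_path_to H (f x) = longest_path_to D x) ->
  #|[set S in sibling_groups D | (S \subset level D i) && (#|S| == k)]| =
  #|[set S in sibling_groups H | (S \subset level H i) && (#|S| == k)]|.
Proof.
move=> bij_f sibE levE; have inj_f := bij_inj bij_f; case: (bij_f) => g fK gK.
have groupE x : [set y in [set: W] | sibling H (f x) y] =
                f @: [set y in [set: V] | sibling D x y].
  apply/setP => y; rewrite -[y]gK (mem_imset _ _ inj_f) !inE.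
  by rewrite sibE.
have levelE (S : {set V}) : (f @: S \subset level H i) = (S \subset level D i).
  by rewrite sub_imset_pre; apply: eq_subset_r => x; rewrite !inE levE.
rewrite -(card_imset _ (imset_inj inj_f)); apply: eq_card => T.
apply/imsetP/idP => [[S] | ].
  rewrite inE => /andP[/imsetP[x _ ->] good] ->.
  by rewrite inE levelE (card_imset _ inj_f) good andbT -groupE imset_f ?inE.
rewrite inE => /andP[/imsetP[y _ ->]]; rewrite -[y]gK groupE levelE.
rewrite (card_imset _ inj_f) => good.
by eexists; last reflexivity; rewrite inE good andbT imset_f ?inE.
Qed.

Theorem proposition5p4 (V W : finType) (D : digraph V) (H : digraph W)
    (acyclicD : acyclic D) (acyclicH : acyclic H)
    (equivDH : bott_equivalent D H) (i k : nat) :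
  #|[set S in sibling_groups D | (S \subset level D i) && (#|S| == k)]| =
  #|[set S in sibling_groups H | (S \subset level H i) && (#|S| == k)]|.
Proof.
case: equivDH => H' HH' [f bij_f fE].
(* A single [r] serves all three digraphs: it is the level function of [H], hence of [H'], and
   [r \o f] is that of [D]. *)
have [r rH] := acyclic_is_level acyclicH.
have [rH' sibE] := bott_steps_invariant HH' rH.
apply: (card_sibling_groups_bij (f := f)) => // [x y | x].
  by rewrite sibE; apply: isomorphic_sibling.
have rD := isomorphic_is_level bij_f fE rH'.
by rewrite (longest_path_to_is_level rH) (longest_path_to_is_level rD).
Qed.
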